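(* Let $A\in\mathbb{R}^{n\times n}$, $B\in\mathbb{R}^{n\times m}$ with $m\le n$, let $(A,B)$ be controllable, let $W\subseteq\mathbb{R}^n$ be nonempty, and let $X\subseteq\mathbb{R}^n$ and $U\subseteq\mathbb{R}^m$ be compact. Let $c\in\mathbb{R}_{>0}$ be a constant such that $\varepsilon'\mathbb{B}\subseteq N_n^{c\varepsilon'}$ for all $\varepsilon'\in\mathbb{R}_{>0}$. Let $\varepsilon\in\mathbb{R}_{>0}$, $\delta=c\varepsilon$, and let $i^*\in\mathbb{Z}_{\ge0}$ be the smallest index $i$ such that $R_i\subseteq R_{i+n}+\varepsilon\mathbb{B}$. Then the set $$R:=\bigcup_{j\in\{1,\dots,n\}}\bigl(R_{i^*+j}+N_j^\delta\bigr)$$ is a subset of $X+\delta\mathbb{B}$ and is robust controlled invariant with respect to the system $\xi(t+1)\in A\xi(t)+B\nu(t)+W$ and the input constraint set $U+\delta\mathbb{B}$.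
   Context: $\mathbb{B}$ denotes the closed unit ball of the infinity norm $|\cdot|$ (in $\mathbb{R}^n$ or $\mathbb{R}^m$ according to context). Sums of sets are Minkowski sums (a sum with the empty set is empty), and $x+W$ means $\{x\}+W$. $(A,B)$ is controllable if $[B,AB,\dots,A^{n-1}B]$ has rank $n$. For $R\subseteq\mathbb{R}^n$, $\operatorname{pre}(R)=\{x\in\mathbb{R}^n\mid \exists u\in U:\ Ax+Bu+W\subseteq R\}$. The sequence $(R_i)_{i\in\mathbb{Z}_{\ge0}}$ is defined by $R_0=X$, $R_{i+1}=\operatorname{pre}(R_i)\cap X$. (An index $i$ with $R_i\subseteq R_{i+n}+\varepsilon\mathbb{B}$ always exists for $\varepsilon>0$.) For $\delta\in\mathbb{R}_{>0}$ the sets $N_i^\delta\subseteq\mathbb{R}^n$ are defined by $N_0^\delta=\{0\}$ and $N_{i+1}^\delta=\{x\in\mathbb{R}^n\mid \exists u\in\delta\mathbb{B}:\ Ax+Bu\in N_i^\delta\}\cap\delta\mathbb{B}$, where $u$ ranges over $\delta\mathbb{B}\subseteq\mathbb{R}^m$. A set $S\subseteq\mathbb{R}^n$ is robust controlled invariant with respect to the system $\xi(t+1)\in A\xi(t)+B\nu(t)+W$ and an input constraint set $U'\subseteq\mathbb{R}^m$ if for every $x\in S$ there exists $u\in U'$ with $Ax+Bu+W\subseteq S$. (The empty set is robust controlled invariant.) *)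

(* Defs.v *)
From HB Require Import structures.
From mathcomp Require Import all_boot all_order all_algebra.
From mathcomp Require Import all_classical all_reals all_analysis.
Set Implicit Arguments.
Unset Strict Implicit.
Unset Printing Implicit Defensive.
Import Order.TTheory GRing.Theory Num.Theory.
Import numFieldNormedType.Exports.
Local Open Scope classical_set_scope.
Local Open Scope ring_scope.

(* R^n is 'cV[R]_n, whose library norm is the infinity norm
   max_i |x i 0| (mx_norm), equal to 0 when n = 0. *)

Definition unit_ball (R : realType) (n : nat) : set 'cV[R]_n :=
  [set x | `|x| <= 1].

Definition scale_set (R : realType) (n : nat) (a : R) (S : set 'cV[R]_n) :
  set 'cV[R]_n := [set a *: x | x in S].

Definition minkowski_sum (R : realType) (n : nat) (S T : set 'cV[R]_n) :
  set 'cV[R]_n := [set x + y | x in S & y in T].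

(* \mxrow_(i < n) concatenates the n x m blocks A^i B, giving the n x nm
   matrix [B, AB, ..., A^(n-1) B]. *)
Definition controllable (R : realType) (n m : nat)
    (A : 'M[R]_n) (B : 'M[R]_(n, m)) : Prop :=
  \rank (\mxrow_(i < n) (A ^+ i *m B)) = n.

Definition pre (R : realType) (n m : nat) (A : 'M[R]_n) (B : 'M[R]_(n, m))
    (W : set 'cV[R]_n) (U : set 'cV[R]_m) (S : set 'cV[R]_n) : set 'cV[R]_n :=
  [set x | exists2 u, U u & minkowski_sum [set A *m x + B *m u] W `<=` S].

Fixpoint pre_seq (R : realType) (n m : nat) (A : 'M[R]_n) (B : 'M[R]_(n, m))
    (W X : set 'cV[R]_n) (U : set 'cV[R]_m) (i : nat) : set 'cV[R]_n :=
  if i is i'.+1 then pre A B W U (pre_seq A B W X U i') `&` X else X.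

Fixpoint null_seq (R : realType) (n m : nat) (A : 'M[R]_n) (B : 'M[R]_(n, m))
    (delta : R) (i : nat) : set 'cV[R]_n :=
  if i is i'.+1 then
    [set x | exists2 u, scale_set delta (@unit_ball R m) u
                      & null_seq A B delta i' (A *m x + B *m u)]
    `&` scale_set delta (@unit_ball R n)
  else [set 0].

Definition robust_controlled_invariant (R : realType) (n m : nat)
    (A : 'M[R]_n) (B : 'M[R]_(n, m)) (W : set 'cV[R]_n) (U : set 'cV[R]_m)
    (S : set 'cV[R]_n) : Prop :=
  forall x, S x ->
    exists2 u, U u & minkowski_sum [set A *m x + B *m u] W `<=` S.

(* Main.v *)
(* Split a state as a + b, with a in R_(istar+j) and b in N_j: the controls of
   a and of b superpose and lower j by one.  When j drops to 0 the successor
   lies in R_istar, hence in R_(istar+n) + eps B, and eps B is contained in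
   N_n, so j restarts from n. *)
Require Import Defs.
From HB Require Import structures.
From mathcomp Require Import all_boot all_order all_algebra.
From mathcomp Require Import all_classical all_reals all_analysis.
Set Implicit Arguments.
Unset Strict Implicit.
Unset Printing Implicit Defensive.
Import Order.TTheory GRing.Theory Num.Theory.
Import numFieldNormedType.Exports.
Local Open Scope classical_set_scope.
Local Open Scope ring_scope.

Lemma pre_seq_subset (R : realType) (n m : nat) (A : 'M[R]_n)
    (B : 'M[R]_(n, m)) (W X : set 'cV[R]_n) (U : set 'cV[R]_m) (i : nat) :
  pre_seq A B W X U i `<=` X.
Proof. by case: i => [//|i] x []. Qed.

Lemma minkowski_sumS (R : realType) (n : nat) (S S' T T' : set 'cV[R]_n) :
  S `<=` S' -> T `<=` T' -> minkowski_sum S T `<=` minkowski_sum S' T'.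
Proof.
move=> SS' TT' _ [x Sx [y Ty <-]].
by exists x; [exact: SS' | exists y; [exact: TT' |]].
Qed.

(** By linearity the two summands of [x] evolve separately. The whole disturbance is charged to the
    [pre_seq] summand, whose control is robust against [W]; the [null_seq] summand then follows the
    disturbance-free dynamics. *)
Lemma minkowski_sum_pre_null_step (R : realType) (n m : nat) (A : 'M[R]_n)
    (B : 'M[R]_(n, m)) (W X : set 'cV[R]_n) (U : set 'cV[R]_m) (delta : R)
    (i j : nat) (x : 'cV[R]_n) :
  minkowski_sum (pre_seq A B W X U i.+1) (null_seq A B delta j.+1) x ->
  exists2 u, minkowski_sum U (scale_set delta (@unit_ball R m)) u &
    minkowski_sum [set A *m x + B *m u] W `<=`
      minkowski_sum (pre_seq A B W X U i) (null_seq A B delta j).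
Proof.
move=> [a [[u Uu au] _] [b [[v dv bv] _] <-]].
exists (u + v); first by exists u => //; exists v.
move=> _ [_ -> [w Ww <-]].
exists (A *m a + B *m u + w).
  by apply: au; exists (A *m a + B *m u) => //; exists w.
exists (A *m b + B *m v) => //.
by rewrite !mulmxDr addrAC; congr (_ + w); rewrite addrACA.
Qed.

Theorem theorem1 (R : realType) (n m : nat) (hmn : (m <= n)%N)
    (A : 'M[R]_n) (B : 'M[R]_(n, m)) (hAB : controllable A B)
    (W : set 'cV[R]_n) (hW : W !=set0)
    (X : set 'cV[R]_n) (hX : compact X)
    (U : set 'cV[R]_m) (hU : compact U)
    (c : R) (hc : 0 < c)
    (hcN : forall eps' : R, 0 < eps' ->
       scale_set eps' (@unit_ball R n) `<=` null_seq A B (c * eps') n)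
    (eps : R) (heps : 0 < eps)
    (delta : R) (hdelta : delta = c * eps)
    (istar : nat)
    (histar : pre_seq A B W X U istar `<=`
       minkowski_sum (pre_seq A B W X U (istar + n))
                     (scale_set eps (@unit_ball R n)))
    (histar_min : forall i : nat,
       pre_seq A B W X U i `<=`
         minkowski_sum (pre_seq A B W X U (i + n))
                       (scale_set eps (@unit_ball R n)) ->
       (istar <= i)%N) :
  let Rset := \bigcup_(j in [set j : nat | (1 <= j <= n)%N])
      minkowski_sum (pre_seq A B W X U (istar + j)) (null_seq A B delta j) in
  Rset `<=` minkowski_sum X (scale_set delta (@unit_ball R n)) /\
  robust_controlled_invariant A B W
    (minkowski_sum U (scale_set delta (@unit_ball R m))) Rset.
Proof.
split.
  (* The union starts at index 1, and every [null_seq] of successor index is cut down to the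
     [delta]-ball by definition. *)
  move=> x [[//|j] _]; apply: minkowski_sumS; first exact: pre_seq_subset.
  by move=> y [].
move=> x [[//|j] /= jn]; rewrite addnS.
move=> /minkowski_sum_pre_null_step[u uU step]; exists u => // y /step {step}.
(* The successor [y] has index [j], one less than that of [x]; it leaves the range of the union only
   when [j = 0]. *)
case: j jn => [n_gt0|j jn] yj; last by exists j.+1 => //=; exact: ltnW.
(* Index [n] is admissible: [x] had index 1, which forces [0 < n]. *)
exists n; first by rewrite /= n_gt0 leqnn.
(* The [null_seq] summand at index 0 is zero, so [y] itself lies in [pre_seq] at [istar]. *)
move: yj; rewrite addn0 => -[z zi [_ -> <-]]; rewrite addr0.
apply: (minkowski_sumS (@subset_refl _ _) _ (histar _ zi)).
by rewrite hdelta; exact: hcN.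
Qed.
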